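(* Let $G$ be a finite group with identity $e$, let $H<G$ be a (proper) subgroup, and let $S\subseteq G$ be such that $e\notin S$, $S=S^{-1}$, and $H^\#\subseteq S$. Then $\Gamma=\mathrm{Cay}(G,S)$ is a Neumaier graph with a regular clique $H$ and parameters $(v,k,\lambda,m,s)$, where $v=|G|$, $k=|S|$, and $s=|H|$, if and only if the following conditions hold: (1) $|T\cap Hg|=m$ for every $g\in G\setminus H$; (2) $|Th\cap T|=\lambda-s+2$ for every $h\in H^\#$; (3) $|Tg\cap T|=\lambda-2m+2$ for every $g\in T$, where $T=S\setminus H^\#$.
   Context: For a subset $X$ of a group, $X^\#$ denotes the set of nonidentity elements of $X$, and $X^{-1}=\{x^{-1}: x\in X\}$. For an identity-free subset $S=S^{-1}$ of a finite group $G$, $\mathrm{Cay}(G,S)$ is the graph with vertex set $G$ in which the neighbourhood of $g$ is $Sg=\{xg: x\in S\}$. A regular clique in a finite regular graph is a clique such that every vertex not in the clique is adjacent to the same positive number of vertices of the clique; if this number is $m$, the clique is called $m$-regular. An edge-regular graph is a regular graph in which every pair of adjacent vertices has a fixed number of common neighbours. A Neumaier graph is a non-complete edge-regular graph containing a regular clique; a $k$-regular Neumaier graph on $v$ vertices has parameters $(v,k,\lambda,m,s)$ if each edge lies in exactly $\lambda$ triangles and the graph has an $m$-regular clique of size $s$.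
   Formalization: The formal theorem additionally assumes that Cay(G,S) is not complete and that m is positive; without these the ''if'' direction fails, e.g. for S = G^# with m = s and λ = v−2, or S = H^# with m = 0 and λ = s−2. *)

(* Defs.v *)
From HB Require Import structures.
From mathcomp Require Import all_boot all_order all_algebra all_fingroup.

Set Implicit Arguments.
Unset Strict Implicit.
Unset Printing Implicit Defensive.

(* A graph on a finite vertex set is given by its adjacency relation. *)

Definition simple_graph (V : finType) (e : rel V) : Prop :=
  symmetric e /\ irreflexive e.

Definition neighborhood (V : finType) (e : rel V) (x : V) : {set V} :=
  [set y | e x y].

Definition complete_graph (V : finType) (e : rel V) : Prop :=
  forall x y : V, x != y -> e x y.

Definition regular_graph (V : finType) (e : rel V) (k : nat) : Prop :=
  forall x : V, #|neighborhood e x| = k.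

(* The number of triangles containing the edge {x, y} is the number of
   common neighbours of x and y. *)
Definition edge_regular (V : finType) (e : rel V) (k lam : nat) : Prop :=
  regular_graph e k /\
  forall x y : V, e x y -> #|neighborhood e x :&: neighborhood e y| = lam.

Definition clique (V : finType) (e : rel V) (C : {set V}) : Prop :=
  {in C &, forall x y : V, x != y -> e x y}.

Definition regular_clique (V : finType) (e : rel V) (m : nat) (C : {set V}) :
    Prop :=
  [/\ clique e C, 0 < m
    & forall x : V, x \notin C -> #|neighborhood e x :&: C| = m].

Definition neumaier_graph (V : finType) (e : rel V) : Prop :=
  [/\ simple_graph e, ~ complete_graph e,
      exists k lam : nat, edge_regular e k lam
    & exists (m : nat) (C : {set V}), regular_clique e m C].

(* C is the clique that witnesses the parameters m and s. *)
Definition neumaier_parameters (V : finType) (e : rel V) (C : {set V})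
    (v k lam m s : nat) : Prop :=
  [/\ #|V| = v, edge_regular e k lam, regular_clique e m C & #|C| = s].

Definition Cay (gT : finGroupType) (S : {set gT}) : rel gT :=
  fun g x => x \in (S :* g)%g.

(* Main.v *)
(* Two vertices x, y have |S :&: S (y x^-1)| common neighbours, so edge
   regularity asks that |S g :&: S| = lam for every g in S.  Adjoining the
   identity to S adds exactly the two elements 1 and g to this intersection,
   and 1 |: S is the disjoint union of H and T.  Splitting accordingly, for
   g in H^# only H and T g :&: T contribute, while for g in T the set H g is
   disjoint from H and H g :&: T, T g :&: H both have m elements. *)

Require Import Defs.
From HB Require Import structures.
From mathcomp Require Import all_boot all_order all_algebra all_fingroup.
From mathcomp Require Import zify.

Set Implicit Arguments.
Unset Strict Implicit.
Unset Printing Implicit Defensive.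

Local Open Scope group_scope.

Lemma cardsU_disjoint (T : finType) (A B : {set T}) :
  [disjoint A & B] -> #|A :|: B| = (#|A| + #|B|)%N.
Proof. by move=> dAB; apply/eqP; rewrite (leq_card_setU A B). Qed.

Lemma rcosetI (gT : finGroupType) (A B : {set gT}) (g : gT) :
  (A :&: B) :* g = A :* g :&: B :* g.
Proof. by apply/setP=> x; rewrite !inE !mem_rcoset inE. Qed.

(** Right translation by [g^-1] is a bijection between the two sets. This moves a translate from one
    side of an intersection to the other, at the price of inverting [g]. *)
Lemma card_rcosetI (gT : finGroupType) (A B : {set gT}) (g : gT) :
  #|A :* g :&: B| = #|A :&: B :* g^-1|.
Proof.
by rewrite -(card_rcoset (A :* g :&: B) g^-1) rcosetI -rcosetM mulgV rcoset1.
Qed.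

Lemma neighborhood_Cay (gT : finGroupType) (S : {set gT}) (x : gT) :
  neighborhood (Cay S) x = S :* x.
Proof. by apply/setP=> y; rewrite inE. Qed.

Lemma card_common_neighbours_Cay (gT : finGroupType) (S : {set gT}) (x y : gT) :
  #|neighborhood (Cay S) x :&: neighborhood (Cay S) y|
    = #|S :* (y * x^-1) :&: S|.
Proof.
rewrite !neighborhood_Cay; apply: etrans (card_rcosetI _ _ _) _.
by rewrite -rcosetM setIC.
Qed.

(** Right translations are automorphisms of the Cayley graph, so only edges from 1 to some [g] in
    [S] need testing; the valency is [#|S|] in any case. *)
Lemma edge_regular_Cay (gT : finGroupType) (S : {set gT}) (lam : nat) :
  edge_regular (Cay S) #|S| lam <->
  (forall g : gT, g \in S -> #|S :* g :&: S| = lam).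
Proof.
split=> [[_ commS] g Sg | commS].
  rewrite -(commS 1 g); last by rewrite /Cay rcoset1.
  by rewrite card_common_neighbours_Cay invg1 mulg1.
split=> [x | x y]; first by rewrite neighborhood_Cay card_rcoset.
by rewrite /Cay mem_rcoset card_common_neighbours_Cay; apply: commS.
Qed.

Lemma simple_graph_Cay (gT : finGroupType) (S : {set gT}) :
  1 \notin S -> S = S^-1 -> simple_graph (Cay S).
Proof.
move=> S_id S_inv; split=> [x y | x].
  by rewrite /Cay !mem_rcoset {1}S_inv mem_invg invMg invgK.
by rewrite /Cay mem_rcoset mulgV (negPf S_id).
Qed.

Lemma clique_Cay (gT : finGroupType) (H : {group gT}) (S : {set gT}) :
  H^# \subset S -> clique (Cay S) H.
Proof.
move=> sHS x y Hx Hy neq_xy; rewrite /Cay mem_rcoset (subsetP sHS) //.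
by rewrite !inE -eq_mulgV1 eq_sym neq_xy groupM ?groupV.
Qed.

(** The new elements are 1, which lies in [S :* g] because [g^-1] is in [S], and [g], which lies in
    [S]. Neither was counted before: 1 is not in [S], hence [g] is not in [S :* g]. *)
Lemma card_rcosetI_id (gT : finGroupType) (S : {set gT}) (g : gT) :
  1 \notin S -> S = S^-1 -> g \in S ->
  #|(1 |: S) :* g :&: (1 |: S)| = (#|S :* g :&: S| + 2)%N.
Proof.
move=> S_id S_inv Sg.
have neq_g1 : g != 1 by apply: contraNneq S_id => <-.
have -> : (1 |: S) :* g :&: (1 |: S) = [set 1; g] :|: (S :* g :&: S).
  apply/setP=> x; rewrite !inE !mem_rcoset !inE -eq_mulgV1.
  have [->|] := eqVneq x 1; last by have [->|] := eqVneq x g; rewrite ?Sg ?orbT.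
  by rewrite mul1g -mem_invg -S_inv Sg orbT.
have dis : [disjoint [set 1; g] & S :* g :&: S].
  rewrite disjoints_subset; apply/subsetP=> x; rewrite !inE mem_rcoset.
  case/pred2P=> ->; first by rewrite (negPf S_id) andbF.
  by rewrite mulgV (negPf S_id).
by rewrite cardsU_disjoint // cards2 eq_sym neq_g1 addnC.
Qed.

Lemma card_setIUU (T : finType) (A B C D : {set T}) :
  [disjoint A & B] -> [disjoint C & D] ->
  #|(A :|: B) :&: (C :|: D)|
    = (#|A :&: C| + #|A :&: D| + #|B :&: C| + #|B :&: D|)%N.
Proof.
move=> dAB dCD; have disjIr (X Y Z : {set T}) :
    [disjoint X & Y] -> [disjoint Z :&: X & Z :&: Y].
  by move=> /disjoint_setI0 dXY; rewrite -setI_eq0 setIACA dXY setI0.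
rewrite setIUl cardsU_disjoint; last by rewrite ![_ :&: (C :|: D)]setIC disjIr.
by rewrite !setIUr !cardsU_disjoint ?disjIr // addnA.
Qed.

Lemma card_rcosetI_split (gT : finGroupType) (H : {group gT}) (S : {set gT})
    (g : gT) (T := S :\: H^#) :
  1 \notin S -> S = S^-1 -> H^# \subset S -> g \in S ->
  (#|S :* g :&: S| + 2 =
    #|H :* g :&: H| + #|H :* g :&: T| + #|T :* g :&: H| + #|T :* g :&: T|)%N.
Proof.
move=> S_id S_inv sHS Sg.
have dHT : [disjoint H & T].
  rewrite disjoint_sym disjoints_subset; apply/subsetP=> x; rewrite !inE.
  by case/andP=> nHx Sx; apply: contra nHx => ->; rewrite andbT;
    apply: contraNneq S_id => <-.
have defS : 1 |: S = H :|: T.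
  rewrite /T; apply/setP=> x; rewrite !inE; have := subsetP sHS x; rewrite !inE.
  have [->|_] /= := eqVneq x 1; first by rewrite group1.
  by case: (x \in H) => // ->.
rewrite -card_rcosetI_id // defS.
have -> : (H :|: T) :* g = H :* g :|: T :* g by rewrite mulUg.
apply: card_setIUU => //.
by rewrite -setI_eq0 -rcosetI (disjoint_setI0 dHT) mul0g.
Qed.

Theorem theorem1p1 (gT : finGroupType) (H : {group gT}) (S : {set gT})
    (lam m : nat)
    (H_proper : H \proper [set: gT])
    (S_id : 1 \notin S)
    (S_inv : S = S^-1)
    (H_sub_S : H^# \subset S)
    (m_gt0 : (0 < m)%N)
    (S_noncomplete : ~ complete_graph (Cay S)) :
  let T := S :\: H^# in
  (neumaier_graph (Cay S) /\
   neumaier_parameters (Cay S) H #|[set: gT]| #|S| lam m #|H|)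
  <->
  [/\ forall g : gT, g \notin H -> #|T :&: H :* g| = m,
      forall h : gT, h \in H^# ->
        (#|T :* h :&: T|%:Z = lam%:Z - #|H|%:Z + 2)%R
    & forall g : gT, g \in T ->
        (#|T :* g :&: T|%:Z = lam%:Z - 2 * m%:Z + 2)%R].
Proof.
move=> T.
(* As 1 is not in [S], removing [H^#] from [S] amounts to removing all of [H]. *)
have memT x : (x \in T) = (x \in S) && (x \notin H).
  rewrite !inE; have [->|_] /= := eqVneq x 1; first by rewrite (negPf S_id).
  by rewrite andbC.
have TIH x : x \in H -> #|T :* x :&: H| = 0%N /\ #|H :* x :&: T| = 0%N.
  move=> Hx; have TH0 : T :&: H = set0.
    by apply/setP=> y; rewrite in_setI memT in_set0; case: (y \in H); rewrite ?andbF.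
  by rewrite card_rcosetI !rcoset_id ?groupV // (setIC H) TH0 cards0.
(* The counts are kept additive in [nat]: [lam - #|H|] can be negative, so conditions (2) and (3)
   are read over the integers and recovered by [lia]. *)
have lamH (g : gT) : g \in H^# -> (#|S :* g :&: S| + 2 = #|H| + #|T :* g :&: T|)%N.
  move=> Hg; rewrite (card_rcosetI_split S_id S_inv H_sub_S) ?(subsetP H_sub_S) //.
  have {Hg}Hg : g \in H by case/setD1P: Hg.
  by rewrite -/T; have [-> ->] := TIH g Hg; rewrite rcoset_id // setIid !addn0.
have lamT (g : gT) : (forall x, x \notin H -> #|T :&: H :* x| = m) -> g \in T ->
    (#|S :* g :&: S| + 2 = 2 * m + #|T :* g :&: T|)%N.
  move=> cardTH Tg; move: (Tg); rewrite memT => /andP[Sg nHg].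
  rewrite (card_rcosetI_split S_id S_inv H_sub_S) // -/T.
  (* Both mixed terms are instances of condition (1), at [g] and, after moving the translate onto
     [H], at [g^-1]. *)
  rewrite [H :* g :&: T]setIC [#|T :* g :&: H|]card_rcosetI !cardTH ?groupV //.
  have -> : H :* g :&: H = set0.
    apply/setP=> x; rewrite !inE mem_rcoset; apply/negP=> /andP[Hxg Hx].
    by case/negP: nHg; rewrite -groupV -(groupMl _ Hx).
  by rewrite cards0 add0n mul2n addnn.
(* Translation turns the left side into [S :&: H :* x^-1]; this coset misses [H], so [S] may be
   replaced by [T]. Clique regularity thus becomes condition (1) at [x^-1]. *)
have neighH x : x \notin H -> #|neighborhood (Cay S) x :&: H| = #|T :&: H :* x^-1|.
  move=> nHx; rewrite neighborhood_Cay card_rcosetI; congr #|pred_of_set _|.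
  apply/setP=> y; rewrite !in_setI memT mem_rcoset invgK.
  case Hyx: (y * x \in H); rewrite ?andbF // !andbT.
  have [Hy|] := boolP (y \in H); last by rewrite andbT.
  by case/negP: nHx; rewrite -(groupMl _ Hy).
split=> [[_ [_ /edge_regular_Cay lamS [_ _ regH] _]] | [cardTH cardTh cardTg]].
  have cardTH g : g \notin H -> #|T :&: H :* g| = m.
    by move=> nHg; rewrite -(regH g^-1) ?groupV // neighH ?groupV // invgK.
  split=> // g Tg.
    by have := lamH g Tg; rewrite lamS ?(subsetP H_sub_S) //; lia.
  have := lamT g cardTH Tg; rewrite lamS; first by lia.
  by move: Tg; rewrite memT => /andP[].
have regS : edge_regular (Cay S) #|S| lam.
  (* [S] is the union of [H^#] and [T], so conditions (2) and (3) between them cover every edge. *)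
  apply/edge_regular_Cay => g Sg; have [Hg|nHg] := boolP (g \in H^#).
    by have := lamH g Hg; have := cardTh g Hg; lia.
  have Tg : g \in T by rewrite in_setD nHg.
  by have := lamT g cardTH Tg; have := cardTg g Tg; lia.
have regH : regular_clique (Cay S) m H.
  split=> //; first exact: clique_Cay.
  by move=> x nHx; rewrite neighH // cardTH ?groupV.
split; last by split=> //; rewrite cardsT.
split=> //; first exact: simple_graph_Cay.
  by exists #|S|, lam.
by exists m, (H : {set gT}).
Qed.
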